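(* Let $m\ge 2$, $n\ge 1$ be integers, $\mathcal{A}\in T_{m,n}$ and $q\in\mathbb{R}^n$. Then TCP$(\mathcal{A},q)$ is solvable (has at least one solution) if and only if the system $$ 0\le \mathcal{A}x^{m-1}+q\le \tau e-u,\quad 0\le x\le \tau^{\frac{m-2}{1-m}}u,\quad u\in\{0,\tau\}^n,\quad \tau\ge 1, $$ in the unknowns $x\in\mathbb{R}^n$, $u\in\mathbb{R}^n$, $\tau\in\mathbb{R}$ is feasible (has a solution $(x,u,\tau)$).
   Context: $[n]=\{1,\ldots,n\}$ and $e=(1,\ldots,1)^\top\in\mathbb{R}^n$. $T_{m,n}$ is the set of all real $m$th-order $n$-dimensional tensors, i.e. arrays $\mathcal{A}=(a_{i_1\ldots i_m})$ of real numbers with $i_1,\ldots,i_m\in[n]$. For $x\in\mathbb{R}^n$, $\mathcal{A}x^{m-1}\in\mathbb{R}^n$ is the vector with components $(\mathcal{A}x^{m-1})_i=\sum_{i_2,\ldots,i_m=1}^{n}a_{ii_2\ldots i_m}x_{i_2}\cdots x_{i_m}$. Vector inequalities are componentwise. The condition $u\in\{0,\tau\}^n$ means that each component of $u$ equals $0$ or $\tau$. The tensor complementarity problem TCP$(\mathcal{A},q)$ is: find $x\in\mathbb{R}^n$ with $x\ge 0$, $\mathcal{A}x^{m-1}+q\ge 0$ and $x^\top(\mathcal{A}x^{m-1}+q)=0$; such an $x$ is called a solution. *)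

(* Defs.v *)
From mathcomp Require Import all_boot all_order all_algebra.
From mathcomp Require Import reals exp.

Set Implicit Arguments.
Unset Strict Implicit.
Unset Printing Implicit Defensive.

Import Order.TTheory GRing.Theory Num.Theory.
Local Open Scope ring_scope.

Definition tensor (R : realType) (m n : nat) := {ffun m.-tuple 'I_n -> R}.

(* (A x^{m-1})_i: the index tuples t = (i_1, ..., i_m) with i_1 = i stand for
   the free indices (i_2, ..., i_m) = behead t, which avoids a cast between m
   and (m.-1).+1. Only meaningful for 0 < m. *)
Definition tensor_app (R : realType) (m n : nat)
    (A : tensor R m n) (x : 'cV[R]_n) : 'cV[R]_n :=
  \col_(i < n) \sum_(t : m.-tuple 'I_n | ohead t == Some i)
                 A t * \prod_(j <- behead t) x j 0.

Definition vle (R : realType) (n : nat) (x y : 'cV[R]_n) : Prop :=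
  forall i, x i 0 <= y i 0.

Definition TCP_solution (R : realType) (m n : nat)
    (A : tensor R m n) (q x : 'cV[R]_n) : Prop :=
  [/\ vle 0 x, vle 0 (tensor_app A x + q)
    & x^T *m (tensor_app A x + q) = 0].

Definition TCP_solvable (R : realType) (m n : nat)
    (A : tensor R m n) (q : 'cV[R]_n) : Prop :=
  exists x : 'cV[R]_n, TCP_solution A q x.

(* Main.v *)
Require Import Defs.
From mathcomp Require Import all_boot all_order all_algebra.
From mathcomp Require Import reals exp.

(** Complementarity of two nonnegative vectors [x] and [y] means that at each
    index one of the two entries vanishes, and [u] records which one: [u i = 0]
    forces [x i = 0], while [u i = tau] forces [y i = 0].  This gives the
    direction from the mixed system to the complementarity problem
    ([mulmx_tr_eq0]).

    For the converse, [tau] only has to be large enough for the remaining upper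
    bounds to hold: [y i <= tau] where [u i = 0], and
    [x i <= tau ^ ((m - 2) / (1 - m)) * tau = tau ^ (1 / (m - 1))] where
    [u i = tau].  If [M >= 1] bounds every entry of [x] and of [y], then
    [tau = M ^ (m - 1)] works: [tau >= M], and the second bound is exactly [M]
    ([powR_scale]). *)

Import Order.TTheory GRing.Theory Num.Theory.
Local Open Scope ring_scope.

Lemma vle0_entry (R : realType) (n : nat) (x : 'cV[R]_n) :
  vle 0 x -> forall i, 0 <= x i 0.
Proof. by move=> x0 i; have := x0 i; rewrite mxE. Qed.

Lemma le_sum_entries (R : realType) (n : nat) (x : 'cV[R]_n) :
  vle 0 x -> forall i, x i 0 <= \sum_j x j 0.
Proof.
move=> x0 i; rewrite (bigD1 i) //= lerDl sumr_ge0 // => j _.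
exact: vle0_entry.
Qed.

(** A sum of nonnegative terms vanishes only if each of its terms does. *)
Lemma mulmx_tr_eq0 (R : realType) (n : nat) (x y : 'cV[R]_n) :
  vle 0 x -> vle 0 y ->
  x^T *m y = 0 <-> forall i, x i 0 = 0 \/ y i 0 = 0.
Proof.
move=> x0 y0; split=> [/matrixP/(_ 0 0) xy i | xy].
  move: xy; rewrite !mxE => /psumr_eq0P xy0.
  have /eqP : x^T 0 i * y i 0 = 0.
    by apply: xy0 => // j _; rewrite mxE mulr_ge0 // vle0_entry.
  by rewrite mxE mulf_eq0 => /orP[] /eqP; [left | right].
apply/matrixP => i j; rewrite !mxE big1 // => k _; rewrite mxE !ord1.
by case: (xy k) => ->; rewrite ?mul0r ?mulr0.
Qed.

(** The exponent of the system is tuned so that, when [tau] is the [(m - 1)]-st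
    power of [M], the bound on [x] becomes [M] itself:
    [(m - 1) * ((m - 2) / (1 - m)) + (m - 1) = 1]. *)
Lemma powR_scale (R : realType) (m : nat) (M : R) : (2 <= m)%N -> 0 < M ->
  powR (M ^+ m.-1) ((m%:R - 2) / (1 - m%:R)) * M ^+ m.-1 = M.
Proof.
case: m => [|[|k]] // _ M0 /=.
have -> : k.+2%:R - 2 = k%:R :> R by rewrite -addn2 natrD addrK.
have -> : 1 - k.+2%:R = - k.+1%:R :> R by rewrite -(addn1 k.+1) natrD opprD addrC subrK.
rewrite -powR_mulrn ?(ltW M0) // -powRrM.
rewrite invrN mulrN mulrN mulrCA divff ?pnatr_eq0 // mulr1.
rewrite -powRD; last by rewrite (gt_eqF M0) implybT.
by rewrite -(addn1 k) natrD addrA addNr add0r powRr1 ?(ltW M0).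
Qed.

Theorem theorem4 (R : realType) (m n : nat) (hm : (2 <= m)%N) (hn : (1 <= n)%N)
    (A : tensor R m n) (q : 'cV[R]_n) :
  TCP_solvable A q <->
  exists (x u : 'cV[R]_n) (tau : R),
    [/\ vle 0 (tensor_app A x + q) /\
          vle (tensor_app A x + q) (tau *: const_mx 1 - u),
        vle 0 x /\ vle x (powR tau ((m%:R - 2) / (1 - m%:R)) *: u),
        forall i : 'I_n, u i 0 = 0 \/ u i 0 = tau
      & 1 <= tau].
Proof.
split=> [[x [x0]] | [x [u [tau [[]]]]]]; last first.
  set y := _ + q => y0 yle [x0 xle] u01 _; exists x; split=> //.
  apply/(mulmx_tr_eq0 _ _ _ _ x0 y0) => i.
  have xi0 := vle0_entry _ _ _ x0 i; have yi0 := vle0_entry _ _ _ y0 i.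
  move: (xle i) (yle i); clearbody y; rewrite !mxE mulr1.
  case: (u01 i) => ->; rewrite ?mulr0 ?subrr => xi yi.
    by left; apply/le_anti; rewrite xi.
  by right; apply/le_anti; rewrite yi.
set y := _ + q => y0 /(mulmx_tr_eq0 _ _ _ _ x0 y0) xy.
pose M : R := 1 + \sum_j x j 0 + \sum_j y j 0.
have sx : 0 <= \sum_j x j 0 by apply: sumr_ge0 => j _; exact: vle0_entry.
have sy : 0 <= \sum_j y j 0 by apply: sumr_ge0 => j _; exact: vle0_entry.
have M1 : 1 <= M by rewrite /M -addrA lerDl addr_ge0.
have M0 : 0 < M := lt_le_trans ltr01 M1.
have xM i : x i 0 <= M.
  by apply: le_trans (le_sum_entries _ _ _ x0 i) _; rewrite /M addrAC lerDr addr_ge0.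
have Mtau : M <= M ^+ m.-1 by rewrite ler_eXnr // -subn1 subn_gt0.
have ytau i : y i 0 <= M ^+ m.-1.
  apply: le_trans Mtau; apply: le_trans (le_sum_entries _ _ _ y0 i) _.
  by rewrite /M lerDr addr_ge0.
exists x, (\col_i (if x i 0 == 0 then 0 else M ^+ m.-1)), (M ^+ m.-1).
split.
- split=> // i; move: (xy i) (ytau i); rewrite -/y; clearbody y.
  rewrite !mxE mulr1; case: eqP => [_ _ | xi [/xi // | -> _]].
    by rewrite subr0.
  by rewrite subrr.
- split=> // i; rewrite !mxE; case: eqP => [->|_]; first by rewrite mulr0.
  by rewrite powR_scale.
- by move=> i; rewrite mxE; case: eqP; [left | right].
- exact: le_trans Mtau.
Qed.
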